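(* Let $\alpha\in(0,\frac29)$. There exists $c_\alpha>0$ so that for all $0<c<c_\alpha$: if $f\in\mathcal{S}_{even}(\mathbb{R})$ is a real function that vanishes together with its Fourier transform at $\pm c\,n^{\alpha}$ for all $n\in\mathbb{N}$, then $f\equiv0$.
   Context: $\mathbb{N}=\{0,1,2,\dots\}$. $\mathcal{S}_{even}(\mathbb{R})$ is the space of even Schwartz functions on $\mathbb{R}$. The Fourier transform is $\widehat f(\xi)=\int_{\mathbb{R}}f(x)e^{-2\pi i x\xi}\,dx$. *)

(* Defs.v *)
From mathcomp Require Import all_boot all_order all_algebra.
From mathcomp Require Import all_classical all_reals all_analysis.
From mathcomp Require Import complex.

Set Implicit Arguments.
Unset Strict Implicit.
Unset Printing Implicit Defensive.

Import Order.TTheory GRing.Theory Num.Theory.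
Import numFieldNormedType.Exports.

Local Open Scope classical_set_scope.
Local Open Scope ring_scope.
Local Open Scope complex_scope.

Definition smooth (R : realType) (f : R -> R) : Prop :=
  forall (n : nat) (x : R), derivable (derive1n n f) x 1.

Definition schwartz (R : realType) (f : R -> R) : Prop :=
  smooth f /\
  forall m n : nat, exists C : R, forall x : R, `|x ^+ m * derive1n n f x| <= C.

Definition schwartz_even (R : realType) (f : R -> R) : Prop :=
  schwartz f /\ forall x : R, f (- x) = f x.

(* e^{i t} *)
Definition cexpi (R : realType) (t : R) : R[i] := cos t +i* sin t.

(* [Rintegral] is a junk value when the integrand is not integrable; Schwartz
   functions are integrable, so this does not matter for them. *)
Definition cintegral (R : realType) (g : R -> R[i]) : R[i] :=
  (\int[@lebesgue_measure R]_x complex.Re (g x))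
  +i* (\int[@lebesgue_measure R]_x complex.Im (g x)).

Definition fourier (R : realType) (f : R -> R) (xi : R) : R[i] :=
  cintegral (fun x : R => (f x)%:C * cexpi (- (2 * pi * x * xi))).

(* Main.v *)
Require Import Defs.
From mathcomp Require Import all_boot all_order all_algebra.
From mathcomp Require Import all_classical all_reals all_analysis.
From mathcomp Require Import measurable_realfun complex ring lra.
Import Order.TTheory GRing.Theory Num.Theory.
Import numFieldNormedType.Exports.
Set Implicit Arguments.
Unset Strict Implicit.
Unset Printing Implicit Defensive.
Local Open Scope ring_scope.
Local Open Scope classical_set_scope.

(** The proof is an uncertainty principle in which dense zeros play the part
    of localisation, used once on each side of the Fourier transform.

    If [g] vanishes at the nodes [a 0 = 0 <= a 1 <= a 2 <= ...], then on each
    gap [g] is controlled by its derivative, with a constant proportional to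
    the length of the gap.  When [a (n+1) * (a (n+1) - a n) <= d] the gaps
    shrink like [1 / x], so the constant also absorbs a factor [x]:
      [int_0^oo (x g)^2 <= d^2 int_0^oo g'^2]  ([weighted_poincare]).

    For an even [f], the Fourier transform at [xi] is twice the half-line
    cosine transform [C f] at [w = 2 pi xi].  Writing [S] for the sine
    transform, [(C f)' = - S (x f)] and [S f' = - w C f].  Put
    [A = int (x f)^2] and [B = int f'^2].  The zeros of [f] give
    [A <= d1^2 B].  The zeros of [C f] give
    [int (S f')^2 <= d2^2 int (S (x f))^2], and by Plancherel for [S] this
    reads [B <= d2^2 A].  Hence [B <= (d1 d2)^2 B], which forces [B = 0], and
    then [f = 0], as soon as [d1 d2 < 1] ([vanishing_of_gaps]).

    For the nodes [c n^alpha] one may take [d1 = c^2]: since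
    [0 < alpha <= 1/2], the increment [(n+1)^alpha - n^alpha] is at most
    [(n+1)^(alpha-1)], and [(n+1)^(2 alpha - 1) <= 1] ([powR_gap]).  On the
    frequency side [c] is replaced by [2 pi c], so the condition is
    [(2 pi c^2)^2 < 1], and [c < 1/4] is enough because [pi < 4].

    Plancherel for [S] ([plancherel_sintrans]) is proved by Abel summation.
    Damping the energy by [exp (- e w)] and exchanging integrals rewrites it
    as [int u(x) V_e(x) dx], where [V_e] is a Poisson smoothing of [u].
    Integrating by parts, [V_e(x) = int u'(y) k_e(x, y) dy] with [k_e] half a
    difference of two arctangents.  These kernels are bounded by [pi / 2] and
    tend to [pi / 2] times the indicator of [y < x], so dominated convergence
    and [u 0 = 0] give [V_e -> pi / 2 * u]. *)

Local Notation mu := (@lebesgue_measure _).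
Local Notation halfline := (`[0%R, +oo[%classic).

(** * Functions of quadratic decay *)

Lemma is_derive_continuous {R : realType} (F f : R -> R) :
  (forall x : R, is_derive x 1 F (f x)) -> continuous F.
Proof.
move=> dF x; apply: differentiable_continuous; apply/derivable1_diffP.
exact: ex_derive.
Qed.

Lemma continuous_sqr {R : realType} (f : R -> R) :
  continuous f -> continuous (fun x => f x ^+ 2).
Proof.
move=> cf x; apply: (@continuous_comp _ _ _ f (fun y => y ^+ 2)); first exact: cf.
exact: exprn_continuous.
Qed.

(** The class carrying all integrations below: stable under sums and products,
    integrable, and vanishing at infinity.  Only the profile [1 / (1 + x^2)] is
    kept of the Schwartz decay. *)
Definition decays {R : realType} (f : R -> R) : Prop :=
  continuous f /\ exists C, forall x, `|f x| <= C / oneDsqr x.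

Lemma integrable_oneDsqrV {R : realType} :
  (@lebesgue_measure R).-integrable setT (EFin \o (fun x => (oneDsqr x)^-1)).
Proof.
apply/integrableP; split.
  apply/measurable_EFinP; apply: continuous_measurable_fun.
  exact: continuous_oneDsqrV.
have p (x : R) : 0 <= (oneDsqr x)^-1 by rewrite invr_ge0.
under eq_integral => x _ do rewrite /= ger0_norm//.
rewrite ge0_symfun_integralT//.
- by rewrite -set_itvcy integral0y_oneDsqr -EFinM ltry.
- exact: continuous_oneDsqrV.
- by move=> x /=; rewrite /oneDsqr sqrrN.
Qed.

Lemma decays_integrableT {R : realType} (f : R -> R) : decays f ->
  (@lebesgue_measure R).-integrable setT (EFin \o f).
Proof.
move=> [cf [C fC]].
apply: (@le_integrable _ _ _ mu _ _ _ (EFin \o (fun x => C * (oneDsqr x)^-1))) => //.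
- by apply/measurable_EFinP; apply: continuous_measurable_fun.
- move=> x _ /=; rewrite lee_fin; apply: (le_trans (fC x)); exact: ler_norm.
- have := @integrableZl _ _ _ mu setT measurableT C _ integrable_oneDsqrV.
  by [].
Qed.

Lemma measurable_halfline {R : realType} : measurable (halfline : set R).
Proof. exact: measurable_itv. Qed.
#[local] Hint Resolve measurable_halfline : core.

Lemma decays_integrable {R : realType} (f : R -> R) : decays f ->
  (@lebesgue_measure R).-integrable halfline (EFin \o f).
Proof.
move=> df; apply: (@integrableS _ _ _ mu setT) => //.
exact: decays_integrableT.
Qed.

Lemma decays_mulr {R : realType} (f g : R -> R) (K : R) : decays f -> continuous g ->
  (forall x, `|g x| <= K) -> decays (fun x => f x * g x).
Proof.
move=> [cf [C fC]] cg gK; split.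
  by move=> x; apply: cvgM; [exact: cf|exact: cg].
exists (C * K) => x; rewrite normrM mulrAC ler_pM//.
Qed.

Lemma decays_bounded {R : realType} (f : R -> R) : decays f ->
  exists K, forall x, `|f x| <= K.
Proof.
move=> [cf [C fC]]; exists C => x; apply: (le_trans (fC x)).
have C0 : 0 <= C.
  have := le_trans (normr_ge0 _) (fC 0).
  by rewrite pmulr_lge0// invr_gt0.
by rewrite ler_pdivrMr// ler_peMr.
Qed.

Lemma decaysM {R : realType} (f g : R -> R) : decays f -> decays g ->
  decays (fun x => f x * g x).
Proof.
by move=> df dg; have [K gK] := decays_bounded dg; apply: (decays_mulr df _ gK); case: dg.
Qed.

Lemma decaysD {R : realType} (f g : R -> R) : decays f -> decays g ->
  decays (fun x => f x + g x).
Proof.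
move=> [cf [C fC]] [cg [K gK]]; split.
  by move=> x; apply: cvgD; [exact: cf|exact: cg].
by exists (C + K) => x; rewrite mulrDl (le_trans (ler_normD _ _))// lerD.
Qed.

Lemma decays_cvg0 {R : realType} (f : R -> R) : decays f ->
  f x @[x --> +oo] --> 0.
Proof.
move=> [cf [C fC]].
apply: norm_cvg0.
apply: (@squeeze_cvgr _ _ _ _ (cst 0) (fun x => C * (oneDsqr x)^-1)).
- by apply: nearW => x; rewrite normr_ge0 fC.
- exact: cvg_cst.
- have h : @oneDsqr R x @[x --> +oo] --> +oo.
    apply/cvgryPge => A; near=> x.
    have : `|A| <= x by near: x; exact: (nbhs_pinfty_ge (num_real _)).
    by rewrite /oneDsqr => Ax; rewrite (le_trans (ler_norm A))//; nra.
  have /gtr0_cvgV0[_ /(_ h)] : \forall x \near +oo, 0 < @oneDsqr R x by near=> x.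
  by move=> h'; rewrite -[X in _ --> X](mulr0 C); apply: cvgMl_tmp.
Unshelve. all: end_near. Qed.

(** * Integration over the half-line *)

Lemma cvg_Rintegral_dominated {R : realType} (D : set R) (f_ : nat -> R -> R)
    (f g : R -> R) :
  measurable D -> (forall n, measurable_fun D (f_ n)) -> measurable_fun D f ->
  {ae mu, forall x, D x -> f_ n x @[n --> \oo] --> f x} ->
  mu.-integrable D (EFin \o g) ->
  (forall n x, D x -> `|f_ n x| <= g x) ->
  \int[mu]_(x in D) f_ n x @[n --> \oo] --> \int[mu]_(x in D) f x.
Proof.
move=> mD mf_ mf f_f gi f_g.
have [] := @dominated_convergence _ _ _ mu D mD (fun n => EFin \o f_ n) (EFin \o f)
  (EFin \o g) => //.
- by move=> n; apply/measurable_EFinP; exact: mf_.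
- by apply/measurable_EFinP; exact: mf.
- move: f_f; apply: filterS; first exact: (ae_filter_ringOfSetsType mu).
  move=> x + Dx => /(_ Dx) h.
  by apply: cvg_EFin; [exact: nearW|exact: h].
- by apply: aeW => x n Dx; rewrite /= lee_fin f_g.
move=> fi _ h.
apply: fine_cvg; rewrite /Rintegral fineK//.
exact: integrable_fin_num.
Qed.

Lemma Rintegral_FTC2 {R : realType} (F f : R -> R) (a b : R) : a <= b ->
  (forall x : R, is_derive x 1 F (f x)) -> continuous f ->
  \int[mu]_(x in `[a, b]) f x = F b - F a.
Proof.
move=> ab dF cf.
have cF : continuous F.
  by move=> x; apply: differentiable_continuous; apply/derivable1_diffP.
move: ab; rewrite le_eqVlt => /predU1P[->|ab].
  by rewrite set_itv1 Rintegral_set1 subrr.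
rewrite /Rintegral (@continuous_FTC2 _ _ F)//.
- by apply: continuous_subspaceT.
- split; first by move=> x _.
  + by apply: cvg_at_right_filter; exact: cF.
  + by apply: cvg_at_left_filter; exact: cF.
- by move=> x _; rewrite derive1E derive_val.
Qed.

Lemma cvg_Rintegral_halfline {R : realType} (f : R -> R) :
  mu.-integrable halfline (EFin \o f) ->
  \int[mu]_(x in `[0, n%:R]) f x @[n --> \oo] --> \int[mu]_(x in halfline) f x.
Proof.
move=> fi.
have mf : measurable_fun (halfline : set R) f.
  by apply/measurable_EFinP; exact: measurable_int fi.
pose g n : R -> R := (f \_ `[0, n%:R])%R.
have sub n : `[0%R, n%:R] `<=` (halfline : set R).
  by apply: subset_itvl; rewrite bnd_simp.
rewrite (_ : (fun n : nat => _) =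
    (fun n : nat => \int[mu]_(x in halfline) g n x)); last first.
  by apply/funext => n; rewrite /g -Rintegral_mkcondr setIidr.
apply: (cvg_Rintegral_dominated (g := fun x => `|f x|)) => //.
- by move=> n; apply/measurable_restrict => //; exact: measurable_funS mf.
- apply: aeW => x /= x0; apply: cvg_near_cst; near=> n.
  rewrite /g patchE mem_set//= in_itv/=; move: x0; rewrite in_itv/= andbT => ->/=.
  near: n; exact: nbhs_infty_ger.
- exact: integrable_norm.
- by move=> n x x0; rewrite /g patchE; case: ifPn => _; rewrite ?normr0.
Unshelve. all: end_near. Qed.

(** The value at infinity is [0], so the only boundary term is the one at [0]. *)
Lemma Rintegral_halfline_derive {R : realType} (F f : R -> R) :
  (forall x : R, is_derive x 1 F (f x)) -> continuous f ->
  mu.-integrable halfline (EFin \o f) -> F x @[x --> +oo] --> 0 ->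
  \int[mu]_(x in halfline) f x = - F 0.
Proof.
move=> dF cf fi F0.
have := cvg_Rintegral_halfline fi.
rewrite (_ : (fun n : nat => _) = (fun n : nat => F n%:R - F 0)); last first.
  by apply/funext => n; rewrite (Rintegral_FTC2 _ dF cf).
move=> /cvg_unique; apply=> //.
have := cvgB (cvg_comp _ _ (@cvgr_idn R) F0) (cvg_cst (F 0)).
by rewrite sub0r; apply.
Qed.

Lemma integrable_mulr_bounded {R : realType} (D : set R) (f g : R -> R) (K : R) :
  measurable D -> mu.-integrable D (EFin \o f) -> measurable_fun D g ->
  (forall x, `|g x| <= K) -> mu.-integrable D (EFin \o (fun x => f x * g x)).
Proof.
move=> mD fi mg gK.
have mf : measurable_fun D f by apply/measurable_EFinP; exact: measurable_int fi.
apply: (@le_integrable _ _ _ mu _ _ _ (fun x => K%:E * `|(f x)%:E|)%E) => //.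
- by apply/measurable_EFinP; exact: measurable_funM.
- move=> x _; rewrite /= lee_fin normrM [leRHS]normrM normr_id mulrC.
  by rewrite ler_wpM2r// (le_trans (gK x))// ler_norm.
- apply: (@integrableZl _ _ _ mu _ mD K (fun x => `|(f x)%:E|)%E).
  exact: integrable_abse.
Qed.

Lemma integrable_mull {R : realType} (D : set R) (c : R) (f : R -> R) :
  measurable D -> mu.-integrable D (EFin \o f) ->
  mu.-integrable D (EFin \o (fun x => c * f x)).
Proof. by move=> mD; exact: (@integrableZl _ _ _ mu _ mD c (EFin \o f)). Qed.

(** For a kernel bounded by [1] the double integral is dominated by
    [`|A x| * `|B y|], whose integral over the product is finite.  Both factors
    are extended by zero so as to work with the product measure on the plane. *)
Lemma Fubini_bounded_kernel {R : realType} (D : set R) (A B : R -> R)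
    (k : R -> R -> R) :
  measurable D ->
  mu.-integrable D (EFin \o A) -> mu.-integrable D (EFin \o B) ->
  measurable_fun setT (fun z : R * R => k z.1 z.2) ->
  (forall x y, `|k x y| <= 1) ->
  \int[mu]_(x in D) (A x * \int[mu]_(y in D) (B y * k x y)) =
  \int[mu]_(y in D) (B y * \int[mu]_(x in D) (A x * k x y)).
Proof.
move=> mD Ai Bi mk k1.
pose a : R -> R := (A \_ D)%R; pose b : R -> R := (B \_ D)%R.
have ai : mu.-integrable setT (EFin \o a).
  rewrite -restrict_EFin; have := (@integrable_mkcond _ _ R mu D (EFin \o A) mD).1 Ai.
  by congr (is_true (integrable _ _ _)).
have bi : mu.-integrable setT (EFin \o b).
  rewrite -restrict_EFin; have := (@integrable_mkcond _ _ R mu D (EFin \o B) mD).1 Bi.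
  by congr (is_true (integrable _ _ _)).
have ma : measurable_fun setT a by apply/measurable_EFinP; exact: measurable_int ai.
have mb : measurable_fun setT b by apply/measurable_EFinP; exact: measurable_int bi.
pose F (z : R * R) := ((a z.1 * b z.2) * k z.1 z.2)%:E.
have mF : measurable_fun setT F.
  apply/measurable_EFinP; apply: measurable_funM => //; apply: measurable_funM.
    by apply: (measurableT_comp ma); exact: measurable_fst.
  by apply: (measurableT_comp mb); exact: measurable_snd.
have mk1 x : measurable_fun setT (k x).
  exact: (measurableT_comp mk (pair1_measurable x)).
have mk2 y : measurable_fun setT (k^~ y).
  exact: (measurableT_comp mk (pair2_measurable y)).
have Fi : (@lebesgue_measure R \x @lebesgue_measure R)%E.-integrable setT F.
  apply/integrable12ltyP => //.
  pose M := (\int[mu]_y `|(b y)%:E|)%E.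
  have Mfin : M \is a fin_num.
    by apply: integrable_fin_num => //; exact: integrable_abse.
  apply: (@le_lt_trans _ _ (\int[mu]_x (M * `|(a x)%:E|))%E); last first.
    rewrite ge0_integralZl//.
    + apply: lte_mul_pinfty => //; first by apply: integral_ge0.
      by case/integrableP : ai.
    + by apply: measurableT_comp => //; apply/measurable_EFinP.
    + by apply: integral_ge0.
  apply: ge0_le_integral => //.
  + by move=> x _; apply: integral_ge0.
  + have := @measurable_fun_fubini_tonelli_F _ _ _ _ R mu (fun z => `|F z|%E).
    by apply => //; exact: measurableT_comp.
  + apply: emeasurable_funM => //.
    by apply: measurableT_comp => //; apply/measurable_EFinP.
  + move=> x _.
    rewrite muleC -ge0_integralZl//; last first.
      by apply: measurableT_comp => //; apply/measurable_EFinP.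
    apply: ge0_le_integral => //.
    * apply: measurableT_comp => //.
      exact: (measurableT_comp mF (pair1_measurable x)).
    * apply: emeasurable_funM => //.
      by apply: measurableT_comp => //; apply/measurable_EFinP.
    * move=> y _; rewrite /F /= lee_fin !normrM ler_piMr//.
have patchM (f g : R -> R) x : (f \_ D)%R x * g x = ((fun z => f z * g z) \_ D)%R x.
  by rewrite !patchE; case: ifP; rewrite ?mul0r.
have inner (f g : R -> R) (c : R) : mu.-integrable setT (EFin \o (f \_ D)%R) ->
    measurable_fun setT g -> (forall y, `|g y| <= 1) ->
    (\int[mu]_y (c * ((f \_ D)%R y * g y))%:E)%E =
    (c * \int[mu]_(y in D) (f y * g y))%:E.
  move=> fi mg g1.
  have fgi := integrable_mulr_bounded measurableT fi mg g1.
  rewrite Rintegral_mkcond; under [in RHS]eq_Rintegral do rewrite -patchM.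
  rewrite -RintegralZl// /Rintegral fineK//.
  apply: integrable_fin_num => //.
  exact: integrable_mull.
have FF := Fubini Fi.
rewrite Rintegral_mkcond [RHS]Rintegral_mkcond /Rintegral.
congr fine; transitivity (\int[mu]_x \int[mu]_y F (x, y))%E.
  apply: eq_integral => x _; rewrite -patchM -inner//.
  by apply: eq_integral => y _; rewrite /F/= mulrA.
rewrite FF; apply: eq_integral => y _; rewrite -patchM -inner//.
by apply: eq_integral => x _; rewrite /F/= mulrCA mulrA.
Qed.

(** * Half-line cosine and sine transforms *)

(** Angular frequency: no factor [2 pi] appears inside the cosine, which
    keeps the formulas for derivatives free of constants. *)
Definition costrans {R : realType} (f : R -> R) (w : R) : R :=
  \int[mu]_(x in halfline) (f x * cos (x * w)).

Definition sintrans {R : realType} (f : R -> R) (w : R) : R :=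
  \int[mu]_(x in halfline) (f x * sin (x * w)).

Lemma is_derive_cosM {R : realType} (x w : R) :
  is_derive w 1 (fun w => cos (x * w)) (- (x * sin (x * w))).
Proof.
apply: is_derive_eq.
rewrite /GRing.scale /=; ring.
Qed.

Lemma is_derive_sinM {R : realType} (x w : R) :
  is_derive w 1 (fun w => sin (x * w)) (x * cos (x * w)).
Proof.
apply: is_derive_eq.
rewrite /GRing.scale /=; ring.
Qed.

Lemma continuous_cosM {R : realType} (x : R) : continuous (fun w : R => cos (x * w)).
Proof. exact: (is_derive_continuous (is_derive_cosM x)). Qed.

Lemma continuous_sinM {R : realType} (x : R) : continuous (fun w : R => sin (x * w)).
Proof. exact: (is_derive_continuous (is_derive_sinM x)). Qed.

Lemma normr_sin_le1 {R : realType} (x : R) : `|sin x| <= 1.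
Proof. by rewrite ler_norml sin_geN1 sin_le1. Qed.

Lemma normr_cos_le1 {R : realType} (x : R) : `|cos x| <= 1.
Proof. by rewrite ler_norml cos_geN1 cos_le1. Qed.

Lemma integrable_mul_cos {R : realType} (D : set R) (f : R -> R) (w : R) :
  measurable D -> mu.-integrable D (EFin \o f) ->
  mu.-integrable D (EFin \o (fun x => f x * cos (x * w))).
Proof.
move=> mD fi; apply: (@integrable_mulr_bounded _ _ _ _ 1) => //.
  apply: measurable_funTS; apply: continuous_measurable_fun.
  by under eq_fun do rewrite mulrC; exact: continuous_cosM.
by move=> x; exact: normr_cos_le1.
Qed.

Lemma integrable_mul_sin {R : realType} (D : set R) (f : R -> R) (w : R) :
  measurable D -> mu.-integrable D (EFin \o f) ->
  mu.-integrable D (EFin \o (fun x => f x * sin (x * w))).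
Proof.
move=> mD fi; apply: (@integrable_mulr_bounded _ _ _ _ 1) => //.
  apply: measurable_funTS; apply: continuous_measurable_fun.
  by under eq_fun do rewrite mulrC; exact: continuous_sinM.
by move=> x; exact: normr_sin_le1.
Qed.

Lemma sintrans_bounded {R : realType} (f : R -> R) :
  mu.-integrable halfline (EFin \o f) ->
  forall w, `|sintrans f w| <= \int[mu]_(x in halfline) `|f x|.
Proof.
move=> fi w; apply: (le_trans (le_normr_Rintegral _ _)) => //.
  exact: integrable_mul_sin.
apply: le_Rintegral => //.
- by apply: integrable_norm; exact: integrable_mul_sin.
- exact: integrable_norm.
- by move=> x _; rewrite normrM ler_piMr// normr_sin_le1.
Qed.

Lemma continuous_sintrans {R : realType} (f : R -> R) :
  mu.-integrable halfline (EFin \o f) -> continuous (sintrans f).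
Proof.
move=> fi w.
have := @continuity_under_integral R _ _ mu (fun w x => f x * sin (x * w)) halfline
  measurable_halfline (w - 1) (w + 1) _ _ (fun x => `|f x|) _ _ w.
apply.
- by move=> v _; exact: integrable_mul_sin.
- apply: aeW => x _ v _.
  by apply: cvgMl_tmp; exact: continuous_sinM.
- exact: integrable_norm.
- move=> v _; apply: aeW => x _.
  by rewrite normrM ler_piMr// normr_sin_le1.
- by rewrite inE/= in_itv/=; lra.
Qed.

Lemma is_derive_costrans {R : realType} (f : R -> R) :
  mu.-integrable halfline (EFin \o f) ->
  mu.-integrable halfline (EFin \o (fun x => x * f x)) ->
  forall w : R, is_derive w 1 (costrans f) (- sintrans (fun x => x * f x) w).
Proof.
move=> fi xfi w.
have dE v x : partial1of2 (fun w x => f x * cos (x * w)) v x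
    = - (x * f x * sin (x * v)).
  rewrite partial1of2E; apply: derive_val.
  have := is_derive_cosM x v; move=> h.
  apply: is_derive_eq.
  rewrite /GRing.scale /=; ring.
have Iw : `]w - 1, w + 1[ w by rewrite /= in_itv/=; lra.
have h1 : forall v, `]w - 1, w + 1[ v -> mu.-integrable halfline
    (EFin \o (fun x => f x * cos (x * v))).
  by move=> v _; exact: integrable_mul_cos.
have h2 : forall v x : R, `]w - 1, w + 1[ v -> halfline x ->
    derivable (fun w => f x * cos (x * w)) v 1.
  move=> v x _ _; have := is_derive_cosM x v; move=> h.
  exact: ex_derive.
have h3 : mu.-integrable halfline (EFin \o (fun x => `|x * f x|)).
  exact: integrable_norm.
have h4 v x : `]w - 1, w + 1[ v -> halfline x ->
    `|partial1of2 (fun w x => f x * cos (x * w)) v x| <= `|x * f x|.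
  by move=> _ _; rewrite dE normrN [leLHS]normrM ler_piMr// normr_sin_le1.
apply: DeriveDef.
  exact: (@derivable_under_integral _ _ _ mu (fun w x => f x * cos (x * w))
    halfline measurable_halfline w _ _ Iw h1 h2 (fun x => `|x * f x|)
    (fun x => normr_ge0 _) h3 h4).
rewrite -derive1E.
rewrite (@differentiation_under_integral _ _ _ mu (fun w x => f x * cos (x * w))
  halfline measurable_halfline w _ _ Iw h1 h2 (fun x => `|x * f x|)
  (fun x => normr_ge0 _) h3 h4).
under eq_Rintegral do rewrite dE -mulN1r.
rewrite RintegralZl//; first by rewrite mulN1r.
exact: integrable_mul_sin.
Qed.

(** Integrate [(f x * sin (x * w))'] over the half-line: the sine kills the
    boundary term at [0]. *)
Lemma sintrans_derive {R : realType} (f f' : R -> R) :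
  (forall x : R, is_derive x 1 f (f' x)) -> decays f -> decays f' ->
  forall w, sintrans f' w = - (w * costrans f w).
Proof.
move=> df ff ff' w.
have cf := decays_integrable ff; have cf' := decays_integrable ff'.
have dp (x : R) : is_derive x 1 (fun x => f x * sin (x * w))
    (f' x * sin (x * w) + w * (f x * cos (x * w))).
  have := is_derive_sinM w x.
  under eq_fun do rewrite mulrC; move=> h.
  apply: is_derive_eq.
  rewrite /GRing.scale /= (mulrC w x); ring.
have := Rintegral_halfline_derive dp.
rewrite mul0r sin0 mulr0 oppr0 => H.
apply/eqP; rewrite -addr_eq0; apply/eqP.
rewrite -H.
- rewrite RintegralD//.
  + by rewrite RintegralZl//; exact: integrable_mul_cos.
  + exact: integrable_mul_sin.
  + by apply: integrable_mull => //; exact: integrable_mul_cos.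
- have c1 : continuous (fun x : R => sin (x * w)).
    by under eq_fun do rewrite mulrC; exact: continuous_sinM.
  have c2 : continuous (fun x : R => cos (x * w)).
    by under eq_fun do rewrite mulrC; exact: continuous_cosM.
  move=> x; apply: cvgD; first by apply: cvgM; [exact: ff'.1|exact: c1].
  by apply: cvgMl_tmp; apply: cvgM; [exact: ff.1|exact: c2].
- have := @integrableD _ _ _ mu _ measurable_halfline _ _
    (integrable_mul_sin w measurable_halfline cf')
    (integrable_mull w measurable_halfline (integrable_mul_cos w measurable_halfline cf)).
  exact.
- apply: decays_cvg0; apply: (@decays_mulr _ _ _ 1) => //.
    by under eq_fun do rewrite mulrC; exact: continuous_sinM.
  by move=> x; exact: normr_sin_le1.
Qed.

(** * Laplace transforms and the Poisson kernel *)

Lemma cvg_expRN {R : realType} (e : R) : 0 < e ->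
  expR (- (e * w)) @[w --> +oo] --> 0.
Proof.
move=> e0.
have h : e * w @[w --> +oo] --> +oo.
  apply/cvgryPge => A; near=> w.
  by rewrite mulrC -ler_pdivrMr.
by have := cvg_comp _ _ h (@cvgr_expR R); apply.
Unshelve. all: end_near. Qed.

Lemma is_derive_expRN {R : realType} (e w : R) :
  is_derive w 1 (fun w => expR (- (e * w))) (- e * expR (- (e * w))).
Proof.
apply: is_derive_eq.
rewrite /GRing.scale /=; ring.
Qed.

Lemma integrable_expRN {R : realType} (e : R) : 0 < e ->
  mu.-integrable halfline (EFin \o (fun w => expR (- (e * w)))).
Proof.
move=> e0.
have ce : continuous (fun w : R => expR (- (e * w))).
  exact: (is_derive_continuous (is_derive_expRN e)).
have d (w : R) : is_derive w 1 (fun w => - e^-1 * expR (- (e * w))) (expR (- (e * w))).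
  have := is_derive_expRN e w => h.
  by apply: is_derive_eq; rewrite /GRing.scale /= mulrA mulrNN mulVf ?mul1r ?gt_eqF.
have l : - e^-1 * expR (- (e * w)) @[w --> +oo] --> 0.
  by rewrite -(mulr0 (- e^-1)); apply: cvgMl_tmp; exact: cvg_expRN.
apply/integrableP; split.
  by apply/measurable_EFinP; apply: measurable_funTS; apply: continuous_measurable_fun.
under eq_integral => w _ do rewrite /= ger0_norm ?expR_ge0//.
rewrite (ge0_continuous_FTC2y _ _ l)//.
- by rewrite -EFinB ltry.
- exact: continuous_subspaceT.
- by apply: cvg_at_right_filter; exact: (is_derive_continuous d).
- by move=> w _; rewrite derive1E derive_val.
Qed.

(** An explicit primitive is [exp (- e w) (t sin (t w) - e cos (t w))] divided
    by [e^2 + t^2]. *)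
Lemma laplace_cos {R : realType} (e t : R) : 0 < e ->
  \int[mu]_(w in halfline) (expR (- (e * w)) * cos (w * t)) =
  e / (e ^+ 2 + t ^+ 2).
Proof.
move=> e0.
have q0 : e ^+ 2 + t ^+ 2 != 0.
  by rewrite gt_eqF// ltr_pwDl ?sqr_ge0// exprn_gt0.
pose g w := expR (- (e * w)) * ((t * sin (t * w) - e * cos (t * w)) / (e ^+ 2 + t ^+ 2)).
have dg (w : R) : is_derive w 1 g (expR (- (e * w)) * cos (w * t)).
  have := is_derive_expRN e w => h1.
  have := is_derive_sinM t w => h2.
  have := is_derive_cosM t w => h3.
  apply: is_derive_eq.
  rewrite /GRing.scale /= (mulrC w t); field.
  exact: q0.
rewrite (Rintegral_halfline_derive dg).
- rewrite /g !mulr0 sin0 cos0 oppr0 expR0; field.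
  exact: q0.
- have h : continuous (fun w : R => expR (- (e * w)) * cos (t * w)).
    move=> w; apply: cvgM; last exact: continuous_cosM.
    exact: (is_derive_continuous (is_derive_expRN e)).
  by under eq_fun do rewrite [_ * t]mulrC.
- by apply: integrable_mul_cos => //; exact: integrable_expRN.
- have h := cvg_expRN e0; rewrite /g.
  (* A bound, uniform in [w], for the bounded factor of the primitive. *)
  pose M := (`|t| + e) / (e ^+ 2 + t ^+ 2).
  apply: norm_cvg0.
  apply: (@squeeze_cvgr _ _ _ _ (cst 0) (fun w => expR (- (e * w)) * M)).
  + apply: nearW => w; rewrite normr_ge0/= normrM ger0_norm ?expR_ge0//.
    rewrite ler_wpM2l ?expR_ge0// normrM [`|_^-1|]ger0_norm; last first.
      by rewrite invr_ge0 addr_ge0 ?sqr_ge0.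
    rewrite ler_wpM2r ?invr_ge0 ?addr_ge0 ?sqr_ge0//.
    rewrite (le_trans (ler_normB _ _))// lerD// normrM ?(gtr0_norm e0).
      by rewrite ler_piMr// normr_sin_le1.
    by rewrite ler_piMr ?normr_cos_le1// ltW.
  + exact: cvg_cst.
  + by rewrite -(mul0r M); exact: cvgMr_tmp.
Qed.

(** The product of the two sines is half the difference of the cosines of
    [(y - x) w] and [(y + x) w], so this is a difference of two Poisson kernels. *)
Lemma laplace_sin_sin {R : realType} (e x y : R) : 0 < e ->
  \int[mu]_(w in halfline) (expR (- (e * w)) * sin (x * w) * sin (y * w)) =
  (e / (e ^+ 2 + (y - x) ^+ 2) - e / (e ^+ 2 + (y + x) ^+ 2)) / 2.
Proof.
move=> e0.
have ei := integrable_expRN e0.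
rewrite -!laplace_cos// -RintegralB//; try exact: integrable_mul_cos.
rewrite -RintegralZr//; last first.
  have := @integrableB _ _ _ mu halfline measurable_halfline _ _
    (integrable_mul_cos (y - x) measurable_halfline ei)
    (integrable_mul_cos (y + x) measurable_halfline ei).
  exact.
apply: eq_Rintegral => w _.
rewrite mulrBr mulrDr cosB cosD (mulrC w y) (mulrC w x).
by field.
Qed.

(** Primitive in [y] of minus the difference of Poisson kernels in
    [laplace_sin_sin].  For [x > 0], [y >= 0] and [y <> x] it tends to [pi / 2]
    times the indicator of [y < x] as [e] tends to [0]; a bounded pointwise
    limit takes the place of the concentration of the Poisson kernel. *)
Definition stepker {R : realType} (e x y : R) : R :=
  (atan ((y + x) / e) - atan ((y - x) / e)) / 2.

Lemma normr_atan_le {R : realType} (x : R) : `|atan x| <= pi / 2.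
Proof. by rewrite ler_norml (ltW (atan_gtNpi2 x)) (ltW (atan_ltpi2 x)). Qed.

Lemma stepker_bounded {R : realType} (e x y : R) : `|stepker e x y| <= pi / 2.
Proof.
rewrite /stepker normrM [`|2^-1|]ger0_norm ?invr_ge0//.
rewrite ler_pdivrMr// (le_trans (ler_normB _ _))// mulr2n mulrDr mulr1.
by rewrite lerD// normr_atan_le.
Qed.

Lemma is_derive_atanD {R : realType} (e s y : R) : 0 < e ->
  is_derive y 1 (fun y => atan ((y + s) / e)) (e / (e ^+ 2 + (y + s) ^+ 2)).
Proof.
move=> e0.
have q0 : e ^+ 2 + (y + s) ^+ 2 != 0.
  by rewrite gt_eqF// ltr_pwDl ?sqr_ge0// exprn_gt0.
apply: is_derive_eq.
rewrite /GRing.scale /=; field.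
by rewrite q0 gt_eqF//=.
Qed.

Lemma is_derive_stepker {R : realType} (e x y : R) : 0 < e ->
  is_derive y 1 (stepker e x)
    ((e / (e ^+ 2 + (y + x) ^+ 2) - e / (e ^+ 2 + (y - x) ^+ 2)) / 2).
Proof.
move=> e0.
have h1 := is_derive_atanD x y e0; have h2 := is_derive_atanD (- x) y e0.
apply: is_derive_eq.
rewrite /GRing.scale /=; ring.
Qed.

Lemma poissonker_bounded {R : realType} (e t : R) : 0 < e ->
  `|e / (e ^+ 2 + t ^+ 2)| <= e^-1.
Proof.
move=> e0.
have q0 : 0 < e ^+ 2 + t ^+ 2 by rewrite ltr_pwDl ?sqr_ge0// exprn_gt0.
rewrite ger0_norm ?divr_ge0 ?(ltW e0) ?(ltW q0)// ler_pdivrMr// mulrC ler_pdivlMr//.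
by rewrite -expr2 lerDl sqr_ge0.
Qed.

Lemma continuous_poissonker {R : realType} (e s : R) : 0 < e ->
  continuous (fun y : R => e / (e ^+ 2 + (y + s) ^+ 2)).
Proof.
move=> e0 y; apply: cvgMl_tmp; apply: cvgV.
  by rewrite gt_eqF// ltr_pwDl ?sqr_ge0// exprn_gt0.
have d (z : R) : is_derive z 1 (fun y : R => e ^+ 2 + (y + s) ^+ 2) (2 * (z + s)).
  by apply: is_derive_eq; rewrite /GRing.scale /=; ring.
exact: (is_derive_continuous d).
Qed.

(** Both boundary terms vanish: [u 0 = 0] at the origin, and the decay of [u]
    against a bounded kernel at infinity. *)
Lemma poisson_by_parts {R : realType} (u u' : R -> R) (e x : R) : 0 < e ->
  (forall y : R, is_derive y 1 u (u' y)) -> u 0 = 0 -> decays u -> decays u' ->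
  \int[mu]_(y in halfline)
    (u y * ((e / (e ^+ 2 + (y - x) ^+ 2) - e / (e ^+ 2 + (y + x) ^+ 2)) / 2)) =
  \int[mu]_(y in halfline) (u' y * stepker e x y).
Proof.
move=> e0 du u0 cu cu'.
pose q y := (e / (e ^+ 2 + (y + x) ^+ 2) - e / (e ^+ 2 + (y - x) ^+ 2)) / 2.
have cq : continuous q.
  move=> y; apply: cvgMr_tmp; apply: cvgB; exact: continuous_poissonker.
have bq y : `|q y| <= e^-1.
  rewrite /q normrM [`|2^-1|]ger0_norm ?invr_ge0//.
  rewrite ler_pdivrMr// (le_trans (ler_normB _ _))// mulr2n mulrDr mulr1.
  by rewrite lerD// poissonker_bounded.
have ds (y : R) := @is_derive_stepker R e x y e0.
have cs := is_derive_continuous ds.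
have d1 : decays (fun y => u' y * stepker e x y).
  exact: (decays_mulr cu' cs (stepker_bounded e x)).
have d2 : decays (fun y => u y * q y) := decays_mulr cu cq bq.
have i1 := decays_integrable d1; have i2 := decays_integrable d2.
have dp (y : R) : is_derive y 1 (fun y => u y * stepker e x y)
    (u' y * stepker e x y + u y * q y).
  by have h := ds y; apply: is_derive_eq; rewrite /GRing.scale /= /q; ring.
have : \int[mu]_(y in halfline) (u' y * stepker e x y)
    + \int[mu]_(y in halfline) (u y * q y) = 0.
  rewrite -RintegralD// (Rintegral_halfline_derive dp).
  - by rewrite u0 mul0r oppr0.
  - by move=> y; apply: cvgD; [exact: d1.1|exact: d2.1].
  - have := @integrableD _ _ _ mu _ measurable_halfline _ _ i1 i2.
    exact.
  - apply: decays_cvg0.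
    exact: (decays_mulr cu cs (stepker_bounded e x)).
move/eqP; rewrite addr_eq0 => /eqP ->.
transitivity (\int[mu]_(y in halfline) (-1 * (u y * q y))); last first.
  by rewrite RintegralZl// mulN1r.
by apply: eq_Rintegral => y _; rewrite /q; ring.
Qed.

Lemma cvg_atan_dilate {R : realType} (c : R) : 0 < c ->
  atan (c / n.+1%:R^-1) @[n --> \oo] --> pi / 2.
Proof.
move=> c0.
have h : (c / n.+1%:R^-1) @[n --> \oo] --> +oo.
  apply/cvgryPge => A; near=> n.
  rewrite invrK mulrC -ler_pdivrMr//.
  apply: (@le_trans _ _ n%:R); last by rewrite ler_nat.
  near: n; exact: nbhs_infty_ger.
by have := cvg_comp _ _ h (@cvgy_atan R); apply.
Unshelve. all: end_near. Qed.

Lemma cvg_stepker {R : realType} (x y : R) : 0 < x -> 0 <= y -> y != x ->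
  stepker n.+1%:R^-1 x y @[n --> \oo] --> (if y < x then pi / 2 else 0).
Proof.
move=> x0 y0 yx.
have yx0 : 0 < y + x by rewrite ltr_wpDl.
have c1 := cvg_atan_dilate yx0.
have [lt|ge] := ltP y x.
  have c2 : atan ((y - x) / n.+1%:R^-1) @[n --> \oo] --> - (pi / 2).
    have c0 : 0 < x - y by rewrite subr_gt0.
    rewrite (_ : (fun n : nat => _) = (fun n : nat => - atan ((x - y) / n.+1%:R^-1))).
      exact: cvgN (cvg_atan_dilate c0).
    by apply/funext => n; rewrite -atanN -mulNr opprB.
  have := cvgMr_tmp (b := 2^-1) (cvgB c1 c2).
  by rewrite opprK -splitr; apply.
have lt : x < y by rewrite lt_neqAle eq_sym yx.
have c2 : 0 < y - x by rewrite subr_gt0.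
have := cvgMr_tmp (b := 2^-1) (cvgB c1 (cvg_atan_dilate c2)).
by rewrite subrr mul0r; apply.
Qed.

(** The limiting integral is [pi / 2 * int_0^x u'], which is [pi / 2 * u x]
    because [u 0 = 0]. *)
Lemma cvg_poisson_smoothing {R : realType} (u u' : R -> R) (x : R) : 0 < x ->
  (forall y : R, is_derive y 1 u (u' y)) -> u 0 = 0 -> decays u' ->
  \int[mu]_(y in halfline) (u' y * stepker n.+1%:R^-1 x y) @[n --> \oo] -->
  pi / 2 * u x.
Proof.
move=> x0 du u0 cu'.
have iu' := decays_integrable cu'.
have e0 n : 0 < n.+1%:R^-1 :> R by rewrite invr_gt0.
have lim : \int[mu]_(y in halfline)
    (((fun y => pi / 2 * u' y) \_ `[0, x[)%R y) = pi / 2 * u x.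
  rewrite -Rintegral_mkcondr setIidr; last first.
    by apply: subset_itvl; rewrite bnd_simp.
  have cx : continuous (fun y => pi / 2 * u' y).
    by move=> y; apply: cvgMl_tmp; exact: cu'.1.
  have dx (y : R) : is_derive y 1 (fun y => pi / 2 * u y) (pi / 2 * u' y).
    by apply: is_derive_eq; rewrite /GRing.scale /=; ring.
  rewrite Rintegral_itv_bndo_bndc; last first.
    apply: (@integrable_mull R _ (pi / 2) u') => //.
    apply: (@integrableS _ _ _ mu halfline) => //.
    by apply: subset_itvl; rewrite bnd_simp.
  by rewrite (Rintegral_FTC2 (ltW x0) dx cx) u0 mulr0 subr0.
rewrite -lim.
apply: (cvg_Rintegral_dominated (g := fun y => pi / 2 * `|u' y|)) => //.
- move=> n; apply: measurable_funTS; apply: continuous_measurable_fun => y.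
  apply: cvgM; first exact: cu'.1.
  exact: (is_derive_continuous (fun y => @is_derive_stepker R _ x y (e0 n))).
- apply/measurable_restrict => //.
  apply: measurable_funTS; apply: continuous_measurable_fun => y.
  by apply: cvgMl_tmp; exact: cu'.1.
(* The kernel has the limit pi / 4 on the diagonal, a single point here. *)
- exists [set x]; split => //; first exact: lebesgue_measure_set1.
  move=> y /= ; apply: contra_notP => /eqP yx y0.
  have {}y0 : 0 <= y by move: y0; rewrite /= in_itv/= andbT.
  have := cvgMl_tmp (a := u' y) (cvg_stepker x0 y0 yx).
  rewrite patchE mem_setE in_itv/= y0/=.
  by case: ifP => _; [rewrite [pi / 2 * _]mulrC|rewrite mulr0]; apply.
- by apply: integrable_mull => //; exact: integrable_norm.
- by move=> n y _; rewrite normrM mulrC ler_wpM2r// stepker_bounded.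
Qed.

(** * Plancherel formula for the sine transform *)

Lemma measurable_sin_kernel {R : realType} :
  measurable_fun setT (fun z : R * R => sin (z.1 * z.2)).
Proof.
apply: measurableT_comp.
  by apply: continuous_measurable_fun; exact: continuous_sin.
by apply: measurable_funM; [exact: measurable_fst|exact: measurable_snd].
Qed.

Lemma integrable_abel {R : realType} (e : R) (g : R -> R) (K : R) : 0 < e ->
  continuous g -> (forall w, `|g w| <= K) ->
  mu.-integrable halfline (EFin \o (fun w => expR (- (e * w)) * g w)).
Proof.
move=> e0 cg gK; apply: (@integrable_mulr_bounded _ _ _ _ K) => //.
  exact: integrable_expRN.
by apply: measurable_funTS; exact: continuous_measurable_fun.
Qed.

(** Inversion formula for the damped sine transform: exchanging the two
    integrals leaves the Laplace transform of a product of two sines. *)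
Lemma abel_inversion {R : realType} (u u' : R -> R) (e x : R) : 0 < e ->
  (forall y : R, is_derive y 1 u (u' y)) -> u 0 = 0 -> decays u -> decays u' ->
  sintrans (fun w => expR (- (e * w)) * sintrans u w) x =
  \int[mu]_(y in halfline) (u' y * stepker e x y).
Proof.
move=> e0 du u0 cu cu'.
have iu := decays_integrable cu.
rewrite -poisson_by_parts//.
transitivity (\int[mu]_(w in halfline) (expR (- (e * w)) * sin (x * w) *
    \int[mu]_(y in halfline) (u y * sin (w * y)))).
  apply: eq_Rintegral => w _; rewrite /sintrans (mulrC w x) mulrAC.
  by congr (_ * _); apply: eq_Rintegral => y _; rewrite (mulrC y w).
rewrite (@Fubini_bounded_kernel _ _ _ u (fun w y => sin (w * y)))//.
- apply: eq_Rintegral => y _; congr (_ * _).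
  rewrite -laplace_sin_sin//.
  by apply: eq_Rintegral => w _; rewrite (mulrC w y).
- apply: (integrable_abel (K := 1)) => //; first exact: continuous_sinM.
  by move=> w; exact: normr_sin_le1.
- exact: measurable_sin_kernel.
- by move=> w y; exact: normr_sin_le1.
Qed.

(** Exchanging the integrals moves one of the two sine transforms away from
    [u], so that the other one can be evaluated by [abel_inversion]. *)
Lemma abel_energy {R : realType} (u : R -> R) (e : R) : 0 < e -> decays u ->
  \int[mu]_(w in halfline) (expR (- (e * w)) * sintrans u w ^+ 2) =
  \int[mu]_(x in halfline)
    (u x * sintrans (fun w => expR (- (e * w)) * sintrans u w) x).
Proof.
move=> e0 cu; have iu := decays_integrable cu.
rewrite -(@Fubini_bounded_kernel _ _ (fun w => expR (- (e * w)) * sintrans u w)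
  u (fun w y => sin (w * y)))//.
- apply: eq_Rintegral => w _; rewrite expr2 mulrA; congr (_ * _).
  by apply: eq_Rintegral => y _; rewrite mulrC (mulrC y w) mulrC.
- apply: (integrable_abel e0); first exact: continuous_sintrans.
  exact: sintrans_bounded.
- exact: measurable_sin_kernel.
- by move=> w y; exact: normr_sin_le1.
Qed.

(** After [abel_energy], the sine transforms paired with [u] converge to
    [pi / 2 * u] and are bounded by [pi / 2 * int |u'|] uniformly in [n], so a
    multiple of [|u|] dominates. *)
Lemma cvg_abel_energy {R : realType} (u u' : R -> R) :
  (forall y : R, is_derive y 1 u (u' y)) -> u 0 = 0 -> decays u -> decays u' ->
  \int[mu]_(w in halfline) (expR (- (n.+1%:R^-1 * w)) * sintrans u w ^+ 2)
    @[n --> \oo] -->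
  \int[mu]_(x in halfline) (u x * (pi / 2 * u x)).
Proof.
move=> du u0 cu cu'.
have iu := decays_integrable cu; have iu' := decays_integrable cu'.
have e0 n : 0 < n.+1%:R^-1 :> R by rewrite invr_gt0.
pose V n := sintrans (fun w => expR (- (n.+1%:R^-1 * w)) * sintrans u w).
have cV n : continuous (V n).
  apply: continuous_sintrans; apply: (integrable_abel (e0 n)).
    exact: continuous_sintrans.
  exact: sintrans_bounded.
have VE n x : V n x = \int[mu]_(y in halfline) (u' y * stepker n.+1%:R^-1 x y).
  by rewrite /V (abel_inversion x (e0 n) du u0 cu cu').
pose K := \int[mu]_(y in halfline) (`|u' y| * (pi / 2)).
have iK : mu.-integrable halfline (EFin \o (fun y => `|u' y| * (pi / 2))).
  apply: (integrable_mulr_bounded (K := `|pi / 2|)) => //.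
  exact: integrable_norm.
have VK n x : `|V n x| <= K.
  rewrite VE; have i1 : mu.-integrable halfline
      (EFin \o (fun y => u' y * stepker n.+1%:R^-1 x y)).
    apply: (integrable_mulr_bounded (K := pi / 2)) => //.
      apply: measurable_funTS; apply: continuous_measurable_fun.
      exact: (is_derive_continuous (fun y => @is_derive_stepker R _ x y (e0 n))).
    exact: stepker_bounded.
  apply: (le_trans (le_normr_Rintegral _ _)) => //.
  apply: le_Rintegral => //; first exact: integrable_norm.
  by move=> y _; rewrite normrM ler_wpM2l// stepker_bounded.
rewrite (_ : (fun n : nat => _) =
    (fun n : nat => \int[mu]_(x in halfline) (u x * V n x))); last first.
  by apply/funext => n; rewrite (abel_energy (e0 n) cu).
apply: (cvg_Rintegral_dominated (g := fun x => `|u x| * K)) => //.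
- move=> n; apply: measurable_funTS; apply: continuous_measurable_fun => x.
  by apply: cvgM; [exact: cu.1|exact: cV].
- apply: measurable_funTS; apply: continuous_measurable_fun => x.
  by apply: cvgM; [exact: cu.1|apply: cvgMl_tmp; exact: cu.1].
(* At [x = 0] the integrand vanishes for every [n], since [u 0 = 0]. *)
- apply: aeW => x; rewrite /= in_itv/= andbT le_eqVlt => /predU1P[<-|x0].
    by rewrite u0 mul0r; under eq_fun do rewrite mul0r; exact: cvg_cst.
  apply: cvgMl_tmp; under eq_fun do rewrite VE.
  exact: cvg_poisson_smoothing.
- apply: (integrable_mulr_bounded (K := `|K|)) => //.
  exact: integrable_norm.
- by move=> n x _; rewrite normrM ler_wpM2l.
Qed.

(** The damped energies increase to the full one, so monotone convergence
    identifies their limit with the one found in [cvg_abel_energy].  Equality in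
    the extended reals says in particular that the transform has finite
    energy. *)
Lemma plancherel_sintrans {R : realType} (u u' : R -> R) :
  (forall y : R, is_derive y 1 u (u' y)) -> u 0 = 0 -> decays u -> decays u' ->
  (\int[mu]_(w in halfline) (sintrans u w ^+ 2)%:E =
   (pi / 2 * \int[mu]_(x in halfline) u x ^+ 2)%:E)%E.
Proof.
move=> du u0 cu cu'.
have iu := decays_integrable cu.
have e0 n : 0 < n.+1%:R^-1 :> R by rewrite invr_gt0.
have cS : continuous (fun w => sintrans u w ^+ 2).
  exact: continuous_sqr (continuous_sintrans iu).
pose g n w := expR (- (n.+1%:R^-1 * w)) * sintrans u w ^+ 2.
have gi n : mu.-integrable halfline (EFin \o g n).
  pose K := \int[mu]_(x in halfline) `|u x|.
  apply: (integrable_abel (e0 n) (K := K ^+ 2)) => // w.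
  by rewrite normrX lerXn2r ?nnegrE// ?sintrans_bounded// Rintegral_ge0.
have mono : (\int[mu]_(w in halfline) (g n w)%:E @[n --> \oo] -->
    \int[mu]_(w in halfline) (sintrans u w ^+ 2)%:E)%E.
  have h (w : R) : expR (- (n.+1%:R^-1 * w)) * sintrans u w ^+ 2 @[n --> \oo]
      --> sintrans u w ^+ 2.
    have h1 : - (n.+1%:R^-1 * w) @[n --> \oo] --> 0.
      have := cvgN (cvgMr_tmp (b := w) (@cvg_harmonic R)).
      by rewrite mul0r oppr0; apply.
    have h2 : expR (- (n.+1%:R^-1 * w)) @[n --> \oo] --> (1 : R).
      have := continuous_cvg _ (@continuous_expR R 0) h1.
      by rewrite expR0; apply.
    have := cvgMr_tmp (b := sintrans u w ^+ 2) h2.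
    by rewrite mul1r; apply.
  rewrite (_ : (\int[mu]_(w in halfline) (sintrans u w ^+ 2)%:E)%E =
    (\int[mu]_(w in halfline) limn (fun n => (g n w)%:E))%E); last first.
    apply: eq_integral => w _; apply/esym/cvg_lim => //.
    by apply: cvg_EFin; [exact: nearW|exact: h].
  apply: cvg_monotone_convergence => //.
  - by move=> n; exact: measurable_int (gi n).
  - by move=> n w _; rewrite lee_fin mulr_ge0 ?expR_ge0 ?sqr_ge0.
  - move=> w; rewrite /= in_itv/= andbT => w0 m n mn; rewrite lee_fin.
    rewrite ler_wpM2r ?sqr_ge0// ler_expR lerN2 ler_wpM2r//.
    by rewrite lef_pV2 ?posrE// ler_nat ltnS.
have lim : (\int[mu]_(w in halfline) (g n w)%:E @[n --> \oo] -->
    (\int[mu]_(x in halfline) (u x * (pi / 2 * u x)))%:E)%E.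
  apply: cvg_EFin.
    by apply: nearW => n; apply: integrable_fin_num => //; exact: gi.
  exact: (cvg_abel_energy du u0 cu cu').
rewrite (cvg_unique _ mono lim)//; congr EFin.
rewrite -RintegralZl//; first by apply: eq_Rintegral => x _; ring.
exact: (decays_integrable (decaysM cu cu)).
Qed.

(** * A weighted Poincare inequality between zeros *)

Lemma continuous_integrable_itv {R : realType} (f : R -> R) (a b : R) :
  continuous f -> mu.-integrable `[a, b] (EFin \o f).
Proof.
move=> cf; apply: continuous_compact_integrable; first exact: segment_compact.
exact: continuous_subspaceT.
Qed.

(** Cauchy-Schwarz for [g y = int_a^y g'], obtained by integrating
    [2 m g' - m^2 <= g'^2] with the optimal slope [m = g y / (y - a)]. *)
Lemma sqr_le_integral_derive {R : realType} (g g' : R -> R) (a y b : R) :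
  a <= y -> y <= b -> (forall x : R, is_derive x 1 g (g' x)) -> continuous g' ->
  g a = 0 ->
  g y ^+ 2 <= (b - a) * \int[mu]_(x in `[a, b]) g' x ^+ 2.
Proof.
move=> ay yb dg cg' ga.
have cg'2 := continuous_sqr cg'.
have I0 : 0 <= \int[mu]_(x in `[a, y]) g' x ^+ 2.
  by apply: Rintegral_ge0 => x _; exact: sqr_ge0.
apply: (@le_trans _ _ ((y - a) * \int[mu]_(x in `[a, y]) g' x ^+ 2)); last first.
  apply: ler_pM => //; [by rewrite subr_ge0|by rewrite lerB|].
  apply: fine_le.
  - by apply: integrable_fin_num => //; exact: continuous_integrable_itv.
  - by apply: integrable_fin_num => //; exact: continuous_integrable_itv.
  - apply: ge0_subset_integral => //.
    + apply: measurable_funTS; apply/measurable_EFinP.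
      exact: continuous_measurable_fun.
    + by move=> x _; rewrite lee_fin sqr_ge0.
    + by apply: subset_itvl; rewrite bnd_simp.
move: ay; rewrite le_eqVlt => /predU1P[<-|ay].
  by rewrite ga subrr mul0r expr0n.
have ya : 0 < y - a by rewrite subr_gt0.
pose m := g y / (y - a).
have dm (x : R) : is_derive x 1 (fun x => 2 * m * g x - m ^+ 2 * x)
    (2 * m * g' x - m ^+ 2).
  by apply: is_derive_eq; rewrite /GRing.scale /=; ring.
have cm : continuous (fun x => 2 * m * g' x - m ^+ 2).
  move=> x; apply: cvgB; last exact: cvg_cst.
  by apply: cvgMl_tmp; exact: cg'.
have := Rintegral_FTC2 (ltW ay) dm cm.
rewrite ga mulr0 => E.
rewrite mulrC -ler_pdivrMr//.
apply: (@le_trans _ _ (\int[mu]_(x in `[a, y]) (2 * m * g' x - m ^+ 2))).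
  rewrite E /m le_eqVlt; apply/orP; left; apply/eqP; field.
  by rewrite gt_eqF.
apply: le_Rintegral => //; try exact: continuous_integrable_itv.
move=> x _; rewrite -subr_ge0.
have -> : g' x ^+ 2 - (2 * m * g' x - m ^+ 2) = (g' x - m) ^+ 2 by ring.
exact: sqr_ge0.
Qed.

Lemma halfline_bigcup {R : realType} (a : nat -> R) :
  a 0%N = 0 -> nondecreasing_seq a -> (forall x, exists n, x < a n) ->
  halfline = \bigcup_n `[a n, a n.+1[%classic.
Proof.
move=> a0 nda ub; apply/seteqP; split => x /=.
  rewrite in_itv/= andbT => x0.
  have ex : exists n, x < a n by exact: ub.
  case: (ex_minnP ex) => -[|n]; first by rewrite a0 ltNge x0.
  move=> xn min; exists n => //=.
  rewrite in_itv/= xn andbT leNgt; apply/negP => /min.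
  by rewrite ltnn.
move=> [n _] /=; rewrite !in_itv/= andbT => /andP[+ _]; apply: le_trans.
by rewrite -a0; apply: nda.
Qed.

Lemma trivIset_itv_nondecreasing {R : realType} (a : nat -> R) :
  nondecreasing_seq a -> trivIset setT (fun n => `[a n, a n.+1[%classic).
Proof.
move=> nda.
have lt_disj i j : (i < j)%N ->
    `[a i, a i.+1[%classic `&` `[a j, a j.+1[%classic = set0.
  move=> ij; rewrite -subset0 => x [] /=; rewrite !in_itv/= => /andP[_ h1] /andP[h2 _].
  have := lt_le_trans h1 (le_trans (nda _ _ ij) h2).
  by rewrite ltxx.
apply/trivIsetP => i j _ _; rewrite neq_ltn => /orP[/lt_disj//|/lt_disj].
by rewrite setIC.
Qed.

(** On the gap from [a n] to [a (n+1)] the pointwise bound of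
    [sqr_le_integral_derive] gives
    [(x g x)^2 <= a_(n+1)^2 (a_(n+1) - a_n) int g'^2]; integrating over the gap
    produces one more length, hence the square of
    [a_(n+1) (a_(n+1) - a_n) <= d].  Sum over [n]. *)
Lemma weighted_poincare {R : realType} (a : nat -> R) (d : R) (g g' : R -> R) :
  a 0%N = 0 -> nondecreasing_seq a -> (forall x, exists n, x < a n) ->
  (forall n, a n.+1 * (a n.+1 - a n) <= d) ->
  (forall x : R, is_derive x 1 g (g' x)) -> continuous g' ->
  (forall n, g (a n) = 0) ->
  (\int[mu]_(x in halfline) ((x * g x) ^+ 2)%:E <=
   (d ^+ 2)%:E * \int[mu]_(x in halfline) (g' x ^+ 2)%:E)%E.
Proof.
move=> a0 nda ub gap dg cg' ga.
have cg := is_derive_continuous dg.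
have age0 n : 0 <= a n by rewrite -a0; exact: nda.
have le_a n : a n <= a n.+1 by exact: nda.
have cxg : continuous (fun x : R => (x * g x) ^+ 2).
  by apply: continuous_sqr => x; apply: cvgM; [exact: cvg_id|exact: cg].
have cg'2 := continuous_sqr cg'.
have mE (D : set R) (h : R -> R) : continuous h -> measurable_fun D (EFin \o h).
  move=> ch; apply: measurable_funTS; apply/measurable_EFinP.
  exact: continuous_measurable_fun.
have hb := halfline_bigcup a0 nda ub.
have ti := trivIset_itv_nondecreasing nda.
have sumE (h : R -> R) : continuous h -> (forall x, 0 <= h x) ->
    (\int[mu]_(x in halfline) (h x)%:E =
     \sum_(n <oo) \int[mu]_(x in `[a n, a n.+1[) (h x)%:E)%E.
  move=> ch h0; rewrite [in LHS]hb ge0_integral_bigcup//; first exact: mE.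
  by move=> x _; rewrite lee_fin.
rewrite (sumE _ cxg (fun x => sqr_ge0 _)) (sumE _ cg'2 (fun x => sqr_ge0 _)).
rewrite -nneseriesZl; last first.
  by move=> n _; apply: integral_ge0 => x _; rewrite lee_fin sqr_ge0.
apply: lee_nneseries.
  by move=> n _ _; apply: integral_ge0 => x _; rewrite lee_fin sqr_ge0.
move=> n _.
pose I := \int[mu]_(x in `[a n, a n.+1]) g' x ^+ 2.
have I0 : 0 <= I by apply: Rintegral_ge0 => x _; exact: sqr_ge0.
have IE : (\int[mu]_(x in `[a n, a n.+1[) (g' x ^+ 2)%:E)%E = I%:E.
  rewrite integral_itv_bndo_bndc; last exact: mE.
  rewrite /I /Rintegral fineK//; apply: integrable_fin_num => //.
  exact: continuous_integrable_itv.
rewrite IE.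
pose K := a n.+1 ^+ 2 * ((a n.+1 - a n) * I).
have gapn : 0 <= a n.+1 - a n by rewrite subr_ge0.
apply: (@le_trans _ _ (\int[mu]_(x in `[a n, a n.+1[) (cst K%:E x))%E).
  apply: ge0_le_integral => //.
  - by move=> x _; rewrite lee_fin sqr_ge0.
  - exact: mE.
  - move=> x; rewrite /= in_itv/= => /andP[ax xa]; rewrite lee_fin exprMn /K.
    have x0 : 0 <= x by apply: le_trans ax.
    apply: ler_pM; rewrite ?sqr_ge0//.
      by rewrite lerXn2r// ?nnegrE// ltW.
    exact: (sqr_le_integral_derive ax (ltW xa) dg cg' (ga n)).
rewrite integral_cst//= lebesgue_measure_itv/= lte_fin.
have -> : (if a n < a n.+1 then ((a n.+1)%:E - (a n)%:E)%E else 0%E) =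
    (a n.+1 - a n)%:E.
  case: ltP => // h; congr EFin; apply/eqP; rewrite eq_sym subr_eq0 eq_le.
  by rewrite h le_a.
rewrite -!EFinM lee_fin /K.
have -> : a n.+1 ^+ 2 * ((a n.+1 - a n) * I) * (a n.+1 - a n) =
  (a n.+1 * (a n.+1 - a n)) ^+ 2 * I by ring.
rewrite ler_wpM2r// lerXn2r// nnegrE ?mulr_ge0//.
by apply: le_trans (gap n); rewrite mulr_ge0.
Qed.

(** * Even Schwartz functions and their Fourier transform *)

Lemma is_derive_smooth {R : realType} (f : R -> R) (n : nat) : smooth f ->
  forall x : R, is_derive x 1 (derive1n n f) (derive1n n.+1 f x).
Proof.
move=> sf x; apply: DeriveDef; first exact: sf.
by rewrite derive1nS derive1E.
Qed.

(** Add the Schwartz bounds for the exponents [m] and [m + 2]. *)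
Lemma schwartz_decays {R : realType} (f : R -> R) (m n : nat) : schwartz f ->
  decays (fun x => x ^+ m * derive1n n f x).
Proof.
move=> [sf bf]; split.
  move=> x; apply: cvgM; first exact: exprn_continuous.
  exact: (is_derive_continuous (is_derive_smooth n sf)).
have [C1 h1] := bf m n; have [C2 h2] := bf m.+2 n.
exists (C1 + C2) => x; rewrite ler_pdivlMr// /oneDsqr mulrDr mulr1 lerD//.
rewrite -[x ^+ 2]ger0_norm ?sqr_ge0// -normrM.
apply: le_trans (h2 x); rewrite le_eqVlt; apply/orP; left; apply/eqP; congr (`|_|).
by rewrite !exprS; ring.
Qed.

(** The two Poincare inequalities, for [f] and for its cosine transform, chain
    into [B <= (d1 d2)^2 B] with [B = int f'^2].  Plancherel is applied to [f']
    and to [x f]; evenness of [f] enters here through [f' 0 = 0]. *)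
Lemma vanishing_of_gaps {R : realType} (f : R -> R) (a b : nat -> R) (d1 d2 : R) :
  schwartz_even f -> 0 <= d1 -> 0 <= d2 -> d1 * d2 < 1 ->
  a 0%N = 0 -> nondecreasing_seq a -> (forall x, exists n, x < a n) ->
  (forall n, a n.+1 * (a n.+1 - a n) <= d1) ->
  b 0%N = 0 -> nondecreasing_seq b -> (forall x, exists n, x < b n) ->
  (forall n, b n.+1 * (b n.+1 - b n) <= d2) ->
  (forall n, f (a n) = 0) -> (forall n, costrans f (b n) = 0) ->
  forall x, f x = 0.
Proof.
move=> [sf ef] d10 d20 d12 a0 nda uba gapa b0 ndb ubb gapb fa fb.
have smf := sf.1.
pose f1 := derive1n 1 f; pose f2 := derive1n 2 f.
have df (x : R) : is_derive x 1 f (f1 x) := is_derive_smooth 0 smf x.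
have df1 (x : R) : is_derive x 1 f1 (f2 x) := is_derive_smooth 1 smf x.
have de m n g : (forall x, x ^+ m * derive1n n f x = g x) -> decays g.
  by move=> /funext <-; exact: schwartz_decays.
have cf : decays f by apply: (de 0%N 0%N) => x; rewrite mul1r.
have cf1 : decays f1 by apply: (de 0%N 1%N) => x; rewrite mul1r.
have cf2 : decays f2 by apply: (de 0%N 2%N) => x; rewrite mul1r.
have cxf : decays (fun x => x * f x) by apply: (de 1%N 0%N).
have cxf1 : decays (fun x => x * f1 x) by apply: (de 1%N 1%N).
have dxf (x : R) : is_derive x 1 (fun x => x * f x) (f x + x * f1 x).
  by apply: is_derive_eq; rewrite /GRing.scale /=; ring.
(* The derivative of an even function is odd. *)
have f10 : f1 0 = 0.
  have dfN : is_derive (0 : R) 1 (fun x : R => f (- x)) (- f1 0).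
    have h : is_derive (- (0 : R)) 1 f (f1 0) by rewrite oppr0.
    by apply: is_derive_eq; rewrite /GRing.scale /=; ring.
  have : f1 0 = - f1 0.
    have e1 := @derive_val _ _ _ _ _ _ _ (df 0); have e2 := @derive_val _ _ _ _ _ _ _ dfN.
    rewrite -[LHS]e1 -[RHS]e2 (_ : (fun x => f (- x)) = f)//.
    by apply/funext => x; rewrite ef.
  by move=> ?; lra.
pose A := \int[mu]_(x in halfline) (x * f x) ^+ 2.
pose B := \int[mu]_(x in halfline) f1 x ^+ 2.
have sqE (g : R -> R) : decays g ->
    (\int[mu]_(x in halfline) (g x ^+ 2)%:E)%E = (\int[mu]_(x in halfline) g x ^+ 2)%:E.
  move=> cg; rewrite /Rintegral fineK//; apply: integrable_fin_num => //.
  by have := decays_integrable (decaysM cg cg).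
have B0 : 0 <= B by apply: Rintegral_ge0 => x _; exact: sqr_ge0.
have AB : A <= d1 ^+ 2 * B.
  have := weighted_poincare a0 nda uba gapa df cf1.1 fa.
  by rewrite (sqE _ cxf) (sqE _ cf1) -EFinM lee_fin.
have BA : B <= d2 ^+ 2 * A.
  have dF := is_derive_costrans (decays_integrable cf) (decays_integrable cxf).
  have cS : continuous (fun w => - sintrans (fun x => x * f x) w).
    by move=> w; apply: cvgN; exact: (continuous_sintrans (decays_integrable cxf)).
  have := weighted_poincare b0 ndb ubb gapb dF cS fb.
  have pl1 := plancherel_sintrans df1 f10 cf1 cf2.
  have pl2 := plancherel_sintrans dxf (mul0r _) cxf (decaysD cf cxf1).
  have wF w : (w * costrans f w) ^+ 2 = sintrans f1 w ^+ 2.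
    by rewrite (sintrans_derive df cf cf1) sqrrN.
  under eq_integral => w _ do rewrite wF.
  under [X in (_ <= _ * X)%E -> _]eq_integral => w _ do rewrite sqrrN.
  by rewrite pl1 pl2 -EFinM lee_fin mulrCA ler_pM2l ?divr_gt0 ?pi_gt0.
have B00 : B = 0.
  apply/eqP; rewrite eq_le B0 andbT.
  have h : B <= (d1 * d2) ^+ 2 * B.
    apply: (le_trans BA).
    have -> : (d1 * d2) ^+ 2 * B = d2 ^+ 2 * (d1 ^+ 2 * B) by ring.
    by rewrite ler_wpM2l ?sqr_ge0.
  have h2 : (d1 * d2) ^+ 2 < 1 by rewrite exprn_ilt1// mulr_ge0.
  by nra.
have nn x : 0 <= x -> f x = 0.
  move=> x0; have f0 : f 0 = 0 by have := fa 0%N; rewrite a0.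
  have h := sqr_le_integral_derive x0 (lexx x) df cf1.1 f0.
  have h2 : \int[mu]_(y in `[0, x]) f1 y ^+ 2 <= B.
    apply: fine_le.
    - apply: integrable_fin_num => //; apply: continuous_integrable_itv.
      exact: continuous_sqr cf1.1.
    - by rewrite (sqE _ cf1).
    - apply: ge0_subset_integral => //.
      + apply: measurable_funTS; apply/measurable_EFinP.
        by apply: continuous_measurable_fun; exact: continuous_sqr cf1.1.
      + by move=> y _; rewrite lee_fin sqr_ge0.
      + by apply: subset_itvl; rewrite bnd_simp.
  have : f x ^+ 2 <= 0.
    have h3 := ler_wpM2l x0 h2; rewrite B00 mulr0 in h3.
    by rewrite subr0 in h; exact: le_trans h h3.
  by move=> h3; apply/eqP; rewrite -sqrf_eq0 eq_le h3 sqr_ge0.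
move=> x; have [x0|x0] := leP 0 x; first exact: nn.
by rewrite -ef nn// oppr_ge0 ltW.
Qed.

(** Adding to [h] an even integrable function that dominates [|h|] reduces to
    the nonnegative case. *)
Lemma Rintegral_even {R : realType} (h : R -> R) :
  decays h -> (forall x, h (- x) = h x) ->
  \int[mu]_x h x = 2 * \int[mu]_(x in halfline) h x.
Proof.
move=> dh eh; have [ch [C hC]] := dh.
pose p (x : R) := C * (oneDsqr x)^-1.
have dp : decays p.
  split; first by move=> x; apply: cvgMl_tmp; exact: continuous_oneDsqrV.
  by exists `|C| => x; rewrite normrM [`|_^-1|]ger0_norm// invr_ge0.
have evE (k : R -> R) : decays k -> (forall x, 0 <= k x) ->
    (forall x, k (- x) = k x) ->
    \int[mu]_x k x = 2 * \int[mu]_(x in halfline) k x.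
  move=> dk k0 ek; rewrite /Rintegral ge0_symfun_integralT//.
  - rewrite -set_itvcy fineM//.
    by apply: integrable_fin_num => //; exact: decays_integrable.
  - exact: dk.1.
  - by move=> x /=; rewrite ek.
have hp0 x : 0 <= h x + p x.
  by have := hC x; rewrite ler_norml -[X in X && _]subr_ge0 opprK => /andP[].
have ep x : p (- x) = p x by rewrite /p /oneDsqr sqrrN.
have p0 x : 0 <= p x := le_trans (normr_ge0 _) (hC x).
have ehp x : h (- x) + p (- x) = h x + p x by rewrite eh ep.
have E1 := evE _ (decaysD dh dp) hp0 ehp.
have E2 := evE _ dp p0 ep.
move: E1; rewrite !RintegralD//;
  try exact: decays_integrable; try exact: decays_integrableT.
by rewrite E2 mulrDr => /addIr.
Qed.

Lemma fourier_eq0_costrans {R : realType} (f : R -> R) (xi : R) :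
  schwartz_even f -> fourier f xi = 0 -> costrans f (2 * pi * xi) = 0.
Proof.
move=> [sf ef] [+ _].
pose h x := f x * cos (x * (2 * pi * xi)).
have dh : decays h.
  have := schwartz_decays 0 0 sf.
  rewrite (_ : (fun x => _) = f); last by apply/funext => x; rewrite mul1r.
  move=> df; apply: (@decays_mulr _ _ _ 1 df).
    by under eq_fun do rewrite mulrC; exact: continuous_cosM.
  by move=> x; exact: normr_cos_le1.
rewrite (_ : (fun x => _) = h); last first.
  apply/funext => x; rewrite /h /= mul0r subr0 cosN.
  by congr (_ * cos _); ring.
rewrite Rintegral_even//.
  by move=> /eqP; rewrite mulf_eq0 pnatr_eq0/= => /eqP.
by move=> x; rewrite /h ef mulNr cosN.
Qed.

(** * The nodes c n^alpha *)

(** With [t = (n+1)^alpha] and [s = n^alpha], monotonicity of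
    [x^(1 - alpha)] gives [n t <= (n+1) s], that is [t - s <= t / (n+1)], and
    [alpha <= 1/2] gives [t^2 <= n+1]. *)
Lemma powR_gap {R : realType} (alpha : R) (n : nat) : 0 < alpha -> alpha <= 2^-1 ->
  n.+1%:R `^ alpha * (n.+1%:R `^ alpha - n%:R `^ alpha) <= 1 :> R.
Proof.
move=> a0 a1.
pose t : R := n.+1%:R `^ alpha; pose s : R := n%:R `^ alpha.
have t0 : 0 <= t by exact: powR_ge0.
have s0 : 0 <= s by exact: powR_ge0.
have split (x : R) : 0 <= x -> x `^ (1 - alpha) * x `^ alpha = x.
  move=> x0; rewrite -powRD ?subrK ?powRr1//.
  by rewrite oner_eq0.
have nt : n%:R * t <= n.+1%:R * s.
  rewrite -[n%:R in leLHS]split// -[n.+1%:R in leRHS]split// -/t -/s.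
  rewrite -!mulrA [t * s]mulrC ler_wpM2r ?mulr_ge0//.
  apply: ge0_ler_powR; rewrite ?nnegrE// ?ler_nat//.
  by rewrite subr_ge0 (le_trans a1)// invf_le1// ler1n.
have t2 : t * t <= n.+1%:R.
  rewrite /t -powRD; last by rewrite pnatr_eq0 implybT.
  rewrite -[leRHS]powRr1//; apply: ler_powR; first by rewrite ler1n.
  by rewrite -mulr2n -mulr_natr -ler_pdivlMr// mul1r.
rewrite -/t -/s.
have n0 : 0 < n.+1%:R :> R by rewrite ltr0n.
rewrite -(ler_pM2l n0) mulr1; apply: le_trans t2.
rewrite mulrCA ler_wpM2l// mulrBr lerBlDl.
by rewrite -natr1 mulrDl mul1r lerD2r natr1.
Qed.

Lemma powR_unbounded {R : realType} (alpha c : R) : 0 < alpha -> 0 < c ->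
  forall x : R, exists n : nat, x < c * n%:R `^ alpha.
Proof.
move=> a0 c0 x.
pose y := `|x| / c + 1.
have y0 : 0 <= y by rewrite addr_ge0// divr_ge0// ltW.
exists (Num.bound (y `^ alpha^-1)).
have := archi_boundP (powR_ge0 y alpha^-1) => h.
have : y <= (Num.bound (y `^ alpha^-1))%:R `^ alpha.
  have {1}-> : y = (y `^ alpha^-1) `^ alpha.
    by rewrite -powRrM mulVf ?gt_eqF// powRr1.
  apply: ge0_ler_powR; rewrite ?nnegrE ?powR_ge0 ?ltW//.
move=> h2; rewrite mulrC -ltr_pdivrMr//; apply: lt_le_trans h2.
by rewrite /y ltr_pwDr// ler_wpM2r ?invr_ge0 ?(ltW c0) ?ler_norm.
Qed.

Theorem corollary5p8 (R : realType) (alpha : R)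
    (halpha0 : 0 < alpha) (halpha : alpha < 2 / 9) :
  exists c_alpha : R, 0 < c_alpha /\
    forall c : R, 0 < c -> c < c_alpha ->
    forall f : R -> R, schwartz_even f ->
      (forall n : nat,
         [/\ f (c * n%:R `^ alpha) = 0,
             f (- (c * n%:R `^ alpha)) = 0,
             fourier f (c * n%:R `^ alpha) = 0
           & fourier f (- (c * n%:R `^ alpha)) = 0]) ->
      forall x : R, f x = 0.
Proof.
(* Any [c] with [2 pi c^2 < 1] works; [1/4] qualifies since [pi < 4]. *)
exists (1 / 4); split; first by lra.
move=> c c0 c4 f sf zf.
have alpha2 : alpha <= 2^-1 by lra.
pose seqn (k : R) (n : nat) := k * n%:R `^ alpha.
have seq0 k : seqn k 0%N = 0 by rewrite /seqn powR0 ?mulr0// gt_eqF.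
have seq_nd k : 0 <= k -> nondecreasing_seq (seqn k).
  move=> k0 m n mn; rewrite /seqn ler_wpM2l//.
  by apply: ge0_ler_powR; rewrite ?nnegrE ?ler_nat// ltW.
have seq_gap k n : seqn k n.+1 * (seqn k n.+1 - seqn k n) <= k ^+ 2.
  have -> : seqn k n.+1 * (seqn k n.+1 - seqn k n) =
      k ^+ 2 * (n.+1%:R `^ alpha * (n.+1%:R `^ alpha - n%:R `^ alpha)).
    by rewrite /seqn; ring.
  by rewrite ler_piMr ?sqr_ge0// powR_gap.
have pi4 : (pi : R) <= 4 by have := @pihalf_lt2 R; lra.
have pi0 : 0 < pi :> R := pi_gt0 R.
have k0 : 0 < 2 * pi * c by rewrite !mulr_gt0.
apply: (@vanishing_of_gaps R f (seqn c) (seqn (2 * pi * c))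
  (c ^+ 2) ((2 * pi * c) ^+ 2)) => //.
- exact: sqr_ge0.
- exact: sqr_ge0.
- have ck0 : 0 <= c * (2 * pi * c) by rewrite mulr_ge0 ?ltW.
  have ck1 : c * (2 * pi * c) < 1 by nra.
  by rewrite -exprMn exprn_ilt1.
- exact: seq_nd (ltW c0).
- exact: powR_unbounded.
- exact: seq_nd (ltW k0).
- exact: powR_unbounded.
- by move=> n; have [] := zf n.
- move=> n; rewrite /seqn -mulrA; apply: fourier_eq0_costrans => //.
  by have [] := zf n.
Qed.
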